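(* Let $\Omega\subset\mathbb{R}^N$, $N\ge2$, be a strictly convex bounded domain and let $g:\partial\Omega\to\mathbb{R}$ be continuous. For $\alpha\in[0,1]$ let $u^*_\alpha$ be the $\alpha$-convex envelope of $g$. Then the map $\alpha\mapsto u^*_\alpha$ is non-increasing (if $\hat\alpha\le\alpha$ then $u^*_\alpha\le u^*_{\hat\alpha}$ pointwise), and it is continuous with respect to the sup-norm: for every $\hat\alpha\in[0,1]$, as $\alpha\to\hat\alpha$ with $\alpha\in[0,1]$, $$u^*_\alpha\to u^*_{\hat\alpha}\quad\text{uniformly in }\overline{\Omega}.$$
   Context: $\Omega$ is strictly convex if $tx+(1-t)y\in\Omega$ for every $x,y\in\overline{\Omega}$, $x\ne y$, and $t\in(0,1)$. For $\alpha\in[0,1]$, $L_\alpha(v)(t)=\alpha v''(t)+(1-\alpha)|v'(t)|^2$. A function $u:\overline{\Omega}\to\mathbb{R}$ is $\alpha$-convex if for any $x,y\in\overline{\Omega}$ one has $u(tx+(1-t)y)\le v(t)$ for all $t\in(0,1)$, where $v$ is the solution of $L_\alpha(v)=0$ in $(0,1)$ with $v(0)=u(y)$, $v(1)=u(x)$. For $\alpha\in(0,1]$, $v$ is the unique classical solution; for $\alpha=0$ the solution is understood in the viscosity sense and is $v(t)=\max\{u(x),u(y)\}$ for $t\in(0,1)$, so that $0$-convex means quasiconvex, while $1$-convex means convex. The $\alpha$-convex envelope of $g$ is $$u^*_\alpha(z)=\sup\{v(z): v:\overline{\Omega}\to\mathbb{R}\text{ is }\alpha\text{-convex and } v|_{\partial\Omega}\le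 g\},\qquad z\in\overline{\Omega}$$ (on $\partial\Omega$ this gives $u^*_\alpha=g$). *)

(* Defs.v *)
From HB Require Import structures.
From mathcomp Require Import all_boot all_order all_algebra.
From mathcomp Require Import all_classical all_reals all_analysis.
Import Order.TTheory GRing.Theory Num.Theory.
Import numFieldNormedType.Exports.

Set Implicit Arguments.
Unset Strict Implicit.
Unset Printing Implicit Defensive.

Local Open Scope ring_scope.
Local Open Scope classical_set_scope.

Section Geometry.
Context {R : realType} {N : nat}.
Implicit Type Omega : set 'rV[R]_N.

(* The norm of 'rV[R]_N is the sup-norm; it is only used for boundedness and
   for the topology, which are those of the Euclidean norm. *)
Definition bounded_domain Omega : Prop :=
  [/\ Omega !=set0, open Omega, connected Omega & bounded_set Omega].

Definition strictly_convex Omega : Prop :=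
  forall x y : 'rV[R]_N, closure Omega x -> closure Omega y -> x != y ->
  forall t : R, 0 < t -> t < 1 -> Omega (t *: x + (1 - t) *: y).

Definition boundary Omega : set 'rV[R]_N := closure Omega `\` interior Omega.

End Geometry.

Section AlphaConvexity.
Context {R : realType}.

Definition Lop (alpha : R) (v : R -> R) (t : R) : R :=
  alpha * (v^`(2))%classic t + (1 - alpha) * `|(v^`())%classic t| ^+ 2.

Definition classical_solution (alpha a b : R) (v : R -> R) : Prop :=
  [/\ {within `[0, 1], continuous v},
      (forall t : R, 0 < t -> t < 1 ->
         [/\ derivable v t 1, derivable v^`() t 1,
             {for t, continuous v^`(2)} & Lop alpha v t = 0]),
      v 0 = a & v 1 = b].

(* For alpha = 0 the viscosity solution is the maximum of the boundary values
   on (0,1); it need not attain the smaller one at the corresponding endpoint. *)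
Definition segment_solution (alpha a b : R) (v : R -> R) : Prop :=
  if alpha == 0 then forall t : R, 0 < t -> t < 1 -> v t = Num.max a b
  else classical_solution alpha a b v.

Context {N : nat}.
Implicit Types (Omega : set 'rV[R]_N) (u g : 'rV[R]_N -> R).

(* Functions on the closure of Omega (resp. its boundary) are represented by
   total functions of which only the values there are used.  For alpha in [0,1]
   a solution v exists and its values on (0,1) are unique. *)
Definition alpha_convex Omega (alpha : R) u : Prop :=
  forall x y : 'rV[R]_N, closure Omega x -> closure Omega y ->
  forall v : R -> R, segment_solution alpha (u y) (u x) v ->
  forall t : R, 0 < t -> t < 1 -> u (t *: x + (1 - t) *: y) <= v t.

Definition envelope_competitor Omega g (alpha : R) : set ('rV[R]_N -> R) :=
  [set v | alpha_convex Omega alpha v /\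
           forall z, boundary Omega z -> v z <= g z].

(* For z in the closure of a strictly convex bounded domain, g continuous and
   alpha in [0,1], this set of values contains min g and is bounded above by
   max g, so the real-valued sup is the genuine least upper bound. *)
Definition alpha_envelope Omega g (alpha : R) (z : 'rV[R]_N) : R :=
  sup [set v z | v in envelope_competitor Omega g alpha].

End AlphaConvexity.

(* Main.v *)
Require Import Defs.
From mathcomp Require Import all_boot all_order all_algebra.
From mathcomp Require Import all_classical all_reals all_analysis.
From mathcomp Require Import ring lra.
Import Order.TTheory GRing.Theory Num.Theory.
Import numFieldNormedType.Exports.

(* Put k = (1 - alpha) / alpha.  For 0 < alpha the solutions of L_alpha v = 0
   are those for which phi_alpha(v) is affine, where phi_alpha(s) = exp (k s)
   (and phi_1(s) = s), so u is alpha-convex iff phi_alpha(u) is convex.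
   Monotonicity is then the comparison of exponential means.

   Continuity at alpha0 > 0: if phi_alpha is h-close to phi_alpha0 and v is a
   competitor for one exponent, the function w given by
   phi_alpha0(w) = phi_alpha(v) - h is a competitor for the other one, and
   w <= v <= w + e.

   Continuity at 0: strict convexity and N >= 2 make the quasiconvex envelope
   u of g uniformly continuous.  For z in the domain and c = u(z) the convex
   set S = {u < c - e/2} is then at distance at least r from z, uniformly in z,
   and exp (k (c - e)) dist(., S) / r is a convex function below exp (k u) as
   soon as k is large; its logarithm over k is a competitor that is at least
   c - e at z. *)

Set Implicit Arguments.
Unset Strict Implicit.
Unset Printing Implicit Defensive.

Local Open Scope ring_scope.
Local Open Scope classical_set_scope.

(** * Exponential reformulation of the ordinary differential equation *)

Section OneDimensional.
Context {R : realType}.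
Implicit Types (f v : R -> R) (a b k s t alpha : R).

(** The derivative [f1] is constant on the open interval, so the mean value theorem on [[0, t]] and
    on [[t, 1]] gives the same slope; the endpoints enter through continuity alone. *)
Lemma affine_of_second_derive0 f (f1 : R -> R) :
    {within `[0, 1], continuous f} ->
    (forall s, 0 < s -> s < 1 -> is_derive s 1 f (f1 s)) ->
    (forall s, 0 < s -> s < 1 -> is_derive s 1 f1 0) ->
  forall t, 0 < t -> t < 1 -> f t = t * f 1 + (1 - t) * f 0.
Proof.
move=> fc df df1 t t0 t1.
have f1_cst c d : 0 < c -> c < d -> d < 1 -> f1 d = f1 c.
  move=> c0 cd d1; apply/eqP; rewrite -subr_eq0; apply/eqP.
  have [||e _ ->] := @MVT R f1 (fun=> 0) c d cd; last by rewrite mul0r.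
    by move=> x; rewrite in_itv /= => /andP[cx xd]; apply: df1; lra.
  apply: derivable_within_continuous => x; rewrite in_itv /= => /andP[cx xd].
  by have [] := df1 x ltac:(lra) ltac:(lra).
have sub_cont a b : 0 <= a -> b <= 1 -> {within `[a, b], continuous f}.
  move=> a0 b1; apply: continuous_subspaceW fc => x /=.
  by rewrite !in_itv /= => /andP[? ?]; apply/andP; split; lra.
have [||c /[!in_itv]/= /andP[c0 ct] E1] := @MVT R f f1 0 t t0.
- by move=> x; rewrite in_itv /= => /andP[? ?]; apply: df; lra.
- by apply: sub_cont => //; lra.
have [||d /[!in_itv]/= /andP[td d1] E2] := @MVT R f f1 t 1 t1.
- by move=> x; rewrite in_itv /= => /andP[? ?]; apply: df; lra.
- by apply: sub_cont => //; lra.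
have E : f1 d = f1 c by apply: f1_cst; lra.
have -> : f t = f 0 + f1 c * t by rewrite subr0 in E1; lra.
have -> : f 1 = f 0 + f1 c * t + f1 c * (1 - t).
  by rewrite subr0 in E1; rewrite E in E2; lra.
by ring.
Qed.

Definition rate alpha : R := (1 - alpha) / alpha.

(** At [alpha = 1] the rate is 0 and the exponential would be constant, hence the separate
    branch. *)
Definition phi alpha s : R := if alpha == 1 then s else expR (rate alpha * s).

Lemma rate_gt0 alpha : 0 < alpha -> alpha < 1 -> 0 < rate alpha.
Proof. by move=> a0 a1; rewrite /rate divr_gt0// subr_gt0. Qed.

Lemma phi1 s : phi 1 s = s.
Proof. by rewrite /phi eqxx. Qed.

Lemma phiE alpha s : alpha < 1 -> phi alpha s = expR (rate alpha * s).
Proof. by move=> a1; rewrite /phi lt_eqF. Qed.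

Lemma ltr_phi alpha : 0 < alpha -> alpha <= 1 -> {mono phi alpha : x y / x < y}.
Proof.
move=> a0; rewrite le_eqVlt => /predU1P[-> x y|a1 x y]; first by rewrite !phi1.
by rewrite !phiE// ltr_expR ltr_pM2l// rate_gt0.
Qed.

Lemma ler_phi alpha : 0 < alpha -> alpha <= 1 -> {mono phi alpha : x y / x <= y}.
Proof. by move=> a0 a1 x y; rewrite leNgt ltr_phi// -leNgt. Qed.

Lemma continuous_phi alpha : continuous (phi alpha).
Proof.
have [->|a1] := eqVneq alpha 1.
  by rewrite (_ : phi 1 = id); [by move=> ?; exact: cvg_id|apply/funext/phi1].
rewrite (_ : phi alpha = fun s => expR (rate alpha * s)); last first.
  by rewrite funeqE => s; rewrite /phi (negbTE a1).
move=> s; apply: continuous_comp; last exact: continuous_expR.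
by apply: continuousM; [exact: cst_continuous|exact: cvg_id].
Qed.

(** For [alpha < 1] and [k = rate alpha], [(exp (k v))'' = (k / alpha) exp (k v) L_alpha v], so the
    equation makes [phi alpha \o v] affine. *)
Lemma phi_classical_solution alpha a b v : 0 < alpha -> alpha <= 1 ->
    classical_solution alpha a b v ->
  forall t, 0 < t -> t < 1 ->
    phi alpha (v t) = t * phi alpha b + (1 - t) * phi alpha a.
Proof.
move=> a0 a1 [vc vs <- <-].
have dv s : 0 < s -> s < 1 -> is_derive s 1 v ((v^`())%classic s).
  by move=> s0 s1; have [vd _ _ _] := vs s s0 s1; rewrite derive1E; split.
have dv1 s : 0 < s -> s < 1 ->
    is_derive s 1 (v^`())%classic ((v^`(2))%classic s).
  move=> s0 s1; have [_ vd _ _] := vs s s0 s1.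
  by rewrite derive1nS derive1n1 derive1E; split.
have L s : 0 < s -> s < 1 -> Lop alpha v s = 0.
  by move=> s0 s1; have [_ _ _] := vs s s0 s1.
have [alpha1|an1] := eqVneq alpha 1.
  move=> t t0 t1; rewrite alpha1 !phi1; apply: affine_of_second_derive0 => //.
    exact: dv.
  move=> s s0 s1; have := dv1 s s0 s1; suff -> : (v^`(2))%classic s = 0 by [].
  by have := L s s0 s1; rewrite /Lop alpha1; lra.
have {}a1 : alpha < 1 by rewrite lt_neqAle an1.
set k := rate alpha.
have ek : alpha * k = 1 - alpha by rewrite /k /rate; field; lra.
pose f s := expR (k * v s).
pose f1 s := expR (k * v s) * (k * (v^`())%classic s).
have df s : 0 < s -> s < 1 -> is_derive s 1 f (f1 s).
  move=> s0 s1; have dvs := dv s s0 s1.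
  have : is_derive s 1 (expR \o (k \*: v)) (f1 s).
    exact: is_derive1_comp.
  by [].
have df1 s : 0 < s -> s < 1 -> is_derive s 1 f1 0.
  move=> s0 s1; have dvs := dv s s0 s1; have dv1s := dv1 s s0 s1.
  have dfs := df s s0 s1.
  have D : is_derive s 1 (f * (k \*: (v^`())%classic))
     (f s *: (k *: (v^`(2))%classic s) + (k *: (v^`())%classic s) *: f1 s).
    exact: is_deriveM.
  apply: (@is_derive_eq _ _ _ f1 s 1 _ _ D).
  have := L s s0 s1; rewrite /Lop real_normK ?num_real// /f1 /f.
  set q := (v^`(2))%classic s.
  rewrite /GRing.scale /=; set e := expR _; set p := (v^`())%classic s.
  rewrite -ek => Lpq; have /eqP : alpha * (q + k * p ^+ 2) = 0.
    by rewrite -Lpq; ring.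
  rewrite mulf_eq0 gt_eqF//= => /eqP H.
  transitivity (e * k * (q + k * p ^+ 2)); [ring|by rewrite H mulr0].
move=> t t0 t1; rewrite !phiE//.
apply: (@affine_of_second_derive0 f f1) => //.
have kvc : {within `[0, 1], continuous (fun s => k * v s)}.
  by move=> s; apply: cvgM; [exact: cvg_cst|exact: vc].
by move=> s; exact: (continuous_comp (kvc s) (@continuous_expR _ _)).
Qed.

(** The inverse of [phi alpha] is applied to the affine interpolation of the transformed end values.
    Existence keeps the quantification over solutions in [alpha_convex] from being vacuous. *)
Lemma classical_solution_exists alpha a b : 0 < alpha -> alpha <= 1 ->
  exists v, classical_solution alpha a b v.
Proof.
move=> a0; rewrite le_eqVlt => /predU1P[->|a1].
  pose v s := a + (b - a) * s.
  have dv s : is_derive s 1 v (b - a).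
    have : is_derive s 1 (cst a + ((b - a) \*: id)) (0 + (b - a) *: 1).
      exact: is_deriveD.
    by rewrite add0r /GRing.scale /= mulr1.
  have v1 : (v^`())%classic = cst (b - a).
    by apply/funext => s; rewrite derive1E derive_val.
  have v2 : (v^`(2))%classic = cst 0.
    rewrite derive1nS derive1n1 v1; apply/funext => s.
    by rewrite derive1E derive_val.
  exists v; split.
  - by apply: derivable_within_continuous => s _.
  - move=> t t0 t1; split=> //.
    + by rewrite v1.
    + by rewrite v2; exact: cst_continuous.
    + by rewrite /Lop v2 /= subrr mulr0 mul0r addr0.
  - by rewrite /v; ring.
  - by rewrite /v; ring.
set k := rate alpha; have k0 : 0 < k by exact: rate_gt0.
have ek : alpha * k = 1 - alpha by rewrite /k /rate; field; lra.
pose q := expR (k * a); pose p := expR (k * b) - q.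
pose w s := p * s + q; pose v s := k^-1 * ln (w s).
have w_gt0 s : 0 <= s -> s <= 1 -> 0 < w s.
  have := expR_gt0 (k * a); have := expR_gt0 (k * b); rewrite -/q => B A.
  move=> s0 s1; rewrite /w /p.
  rewrite (_ : _ + _ = s * expR (k * b) + (1 - s) * q); last by ring.
  have [->|sn0] := eqVneq s 0; first by rewrite mul0r add0r subr0 mul1r.
  by rewrite ltr_wpDr ?mulr_gt0 ?mulr_ge0 ?lt_neqAle ?(eq_sym 0) ?sn0//; lra.
have dw s : is_derive s 1 w p.
  have : is_derive s 1 ((p \*: id) + cst q) (p *: 1 + 0).
    exact: is_deriveD.
  by rewrite addr0 /GRing.scale /= mulr1.
have wc : continuous w.
  move=> s; apply: differentiable_continuous; apply/derivable1_diffP.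
  by have [] := dw s.
have dv s : 0 < w s -> is_derive s 1 v (k^-1 * (p / w s)).
  move=> ws; have dl := is_derive1_ln ws.
  have : is_derive s 1 (k^-1 \*: (@ln R \o w)) (k^-1 *: ((w s)^-1 * p)).
    by apply: is_deriveZ; exact: is_derive1_comp.
  by rewrite [_ * p]mulrC.
(* The formula for [v'] is proved where [w] is positive; this is an open condition, so the formula
   holds near such a [t] and may be differentiated again. *)
have w_near t : 0 < w t -> \forall s \near t, 0 < w s.
  by move=> wt; exact: (cvgr_gt _ (wc t) _ wt).
have v1 s : 0 < w s -> (v^`())%classic s = k^-1 * (p / w s).
  by move=> ws; have := dv s ws; rewrite derive1E => ?; rewrite derive_val.
have dv1 t : 0 < w t ->
    is_derive t 1 (v^`())%classic (- k^-1 * p ^+ 2 * (w t) ^- 2).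
  move=> wt.
  apply: (@near_eq_is_derive _ _ _ (fun s => k^-1 * (p / w s))).
    by apply: filterS (w_near t wt) => s ws; rewrite v1.
  have wt0 : w t != 0 by rewrite gt_eqF.
  have D := @is_deriveV R w t p 1 wt0 (dw t).
  have : is_derive t 1 ((k^-1 * p) \*: (fun s => (w s)^-1))
     ((k^-1 * p) *: (- (w t) ^- 2 *: p)).
    exact: is_deriveZ.
  rewrite (_ : (_ \*: _) = (fun s => k^-1 * (p / w s))); last first.
    by apply/funext => s /=; rewrite /GRing.scale /= mulrA.
  rewrite (_ : (k^-1 * p) *: _ = (- k^-1 * p ^+ 2 * (w t) ^- 2))//.
  by rewrite /GRing.scale /=; ring.
have v2 s : 0 < w s -> (v^`(2))%classic s = - k^-1 * p ^+ 2 * (w s) ^- 2.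
  move=> ws; have := dv1 s ws; rewrite derive1nS derive1n1 derive1E => ?.
  by rewrite derive_val.
exists v; split.
- apply: derivable_within_continuous => s /[!in_itv]/= /andP[s0 s1].
  by have [] := dv s (w_gt0 s s0 s1).
- move=> t t0 t1; have wt : 0 < w t by rewrite w_gt0 ?ltW.
  split.
  + by have [] := dv t wt.
  + by have [] := dv1 t wt.
  + suff : (v^`(2))%classic @ t --> (v^`(2))%classic t by [].
    rewrite [X in _ --> X]v2//.
    have ct : (- k^-1 * p ^+ 2 * (w s) ^- 2) @[s --> t] --> - k^-1 * p ^+ 2 * (w t) ^- 2.
      apply: cvgM; first exact: cvg_cst.
      by apply: cvgV; [rewrite sqrf_eq0 gt_eqF|apply: cvgM; exact: wc].
    apply: cvg_trans ct; apply: near_eq_cvg.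
    by apply: filterS (w_near t wt) => s ws; rewrite v2.
  + rewrite /Lop v2// v1// real_normK ?num_real// -ek.
    by field; rewrite !gt_eqF.
- by rewrite /v /w mulr0 add0r /q expRK mulrA mulVf ?mul1r ?gt_eqF.
- by rewrite /v /w /p mulr1 subrK expRK mulrA mulVf ?mul1r ?gt_eqF.
Qed.

End OneDimensional.

(** * Distance to a set, convexity, and comparison of means *)

Section Metric.
Context {R : realType} {V : normedModType R}.
Implicit Types (A D : set V) (x y z : V).

Lemma open_normP A : open A ->
  forall x, A x -> exists2 e : R, 0 < e & forall y, `|x - y| < e -> A y.
Proof.
move=> oA x Ax; have /nbhs_ballP[e /= e0 eA] := open_nbhs_nbhs (conj oA Ax).
by exists e => // y xy; apply: eA; rewrite -ball_normE.
Qed.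

Lemma closure_normP A x :
  closure A x <-> forall e : R, 0 < e -> exists2 a, A a & `|x - a| < e.
Proof.
split=> [cx e e0|H B /nbhs_ballP[e /= e0 eB]].
  have [a [Aa]] := cx _ (nbhsx_ballx x e e0).
  by rewrite -ball_normE => xa; exists a.
have [a Aa xa] := H e e0; exists a; split => //.
by apply: eB; rewrite -ball_normE.
Qed.

Definition dist D x : R := inf [set `|x - a| | a in D].

Lemma dist_le D x a : D a -> dist D x <= `|x - a|.
Proof.
move=> Da; apply: ge_inf; last by exists a.
by exists 0 => _ [b _ <-].
Qed.

Lemma le_dist D x (r : R) : D !=set0 ->
  (forall a, D a -> r <= `|x - a|) -> r <= dist D x.
Proof.
move=> [a Da] H; apply: lb_le_inf; first by exists `|x - a|, a.
by move=> _ [b Db <-]; exact: H.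
Qed.

Lemma dist_adherent D x (e : R) : D !=set0 -> 0 < e ->
  exists2 a, D a & `|x - a| < dist D x + e.
Proof.
move=> D0 e0; apply: contrapT => H.
suff : dist D x + e <= dist D x by rewrite gerDl leNgt e0.
apply: le_dist => // a Da; rewrite leNgt; apply/negP => ?; apply: H.
by exists a.
Qed.

Lemma dist_ge0 D x : D !=set0 -> 0 <= dist D x.
Proof. by move=> D0; exact: le_dist. Qed.

Lemma dist_lip D x y : D !=set0 -> `|dist D x - dist D y| <= `|x - y|.
Proof.
move=> D0; suff H u v : dist D u - dist D v <= `|u - v|.
  by rewrite ler_norml lerNl opprB H distrC H.
rewrite lerBlDr -lerBlDl; apply: le_dist => // a Da; rewrite lerBlDl.
by apply: le_trans (dist_le u Da) _; exact: ler_distD.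
Qed.

Lemma dist_continuous D : D !=set0 -> continuous (dist D).
Proof.
move=> D0 x; apply/cvgrPdist_lt => e e0; apply/nbhs_ballP; exists e => //= y.
by rewrite -ball_normE; apply: le_lt_trans; exact: dist_lip.
Qed.

Lemma dist_eq0 D x : D !=set0 -> dist D x = 0 -> closure D x.
Proof.
move=> D0 d0; apply/closure_normP => e /(dist_adherent x D0)[a Da].
by rewrite d0 add0r; exists a.
Qed.

End Metric.

Section Convexity.
Context {R : realType} {V : lmodType R}.
Implicit Types (D : set V) (f : V -> R).

Definition convex_on D f := forall x y, D x -> D y -> forall t : R,
  0 < t -> t < 1 -> f (t *: x + (1 - t) *: y) <= t * f x + (1 - t) * f y.

Definition quasiconvex_on D f := forall x y, D x -> D y -> forall t : R,
  0 < t -> t < 1 -> f (t *: x + (1 - t) *: y) <= Num.max (f x) (f y).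

End Convexity.

(** Points of [D] nearly realizing the distances from [x] and [y] combine, with the same weights, to
    a point of [D]; the triangle inequality does the rest. *)
Lemma dist_convex {R : realType} {V : normedModType R} (D E : set V) :
    D !=set0 ->
    (forall x y, D x -> D y -> forall t : R, 0 < t -> t < 1 ->
       D (t *: x + (1 - t) *: y)) ->
  convex_on E (dist D).
Proof.
move=> D0 cD x y _ _ t t0 t1; apply/ler_addgt0Pr => e e0.
have [a Da xa] := dist_adherent x D0 e0.
have [b Db yb] := dist_adherent y D0 e0.
apply: le_trans (dist_le _ (cD _ _ Da Db t t0 t1)) _.
rewrite (_ : _ - _ = t *: (x - a) + (1 - t) *: (y - b)); last first.
  by rewrite !scalerBr opprD !addrA; congr (_ - _); rewrite addrAC.
apply: le_trans (ler_normD _ _) _; rewrite !normrZ !gtr0_norm ?subr_gt0//.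
by nra.
Qed.

Section Comparison.
Context {R : realType}.
Implicit Types (a b k s t alpha : R).

(** The tangent line of [expR] at the mean [c] lies below the graph; averaging it at [a] and [b]
    cancels the linear term. *)
Lemma convex_expR_mean a b t : 0 < t -> t < 1 ->
  expR (t * a + (1 - t) * b) <= t * expR a + (1 - t) * expR b.
Proof.
move=> t0 t1; set c := t * a + _.
have H x : expR c * (1 + (x - c)) <= expR x.
  have -> : expR x = expR c * expR (x - c) by rewrite -expRD subrKC.
  by rewrite ler_pM2l ?expR_gt0//; exact: expR_ge1Dx.
have := H a; have := H b; have := expR_gt0 c.
rewrite /c => *; nra.
Qed.

Lemma phi_mean_le_max alpha s a b t : 0 < alpha -> alpha <= 1 ->
    0 < t -> t < 1 ->
    phi alpha s <= t * phi alpha a + (1 - t) * phi alpha b ->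
  s <= Num.max a b.
Proof.
move=> a0 a1 t0 t1 H; rewrite -(ler_phi a0 a1).
have A : phi alpha a <= phi alpha (Num.max a b).
  by rewrite ler_phi// le_max lexx.
have B : phi alpha b <= phi alpha (Num.max a b).
  by rewrite ler_phi// le_max lexx orbT.
nra.
Qed.

(** For [alpha < 1], divide by [phi alpha s] and put [q = k / k0 < 1]: since
    [y ^ q <= q y + (1 - q)], a mean of [exp (k (x - s))] that is at least 1 forces the same for
    [exp (k0 (x - s))]. For [alpha = 1] this is Jensen's inequality for [expR]. *)
Lemma phi_mean_antitone alpha0 alpha s a b t :
    0 < alpha0 -> alpha0 <= alpha -> alpha <= 1 -> 0 < t -> t < 1 ->
    phi alpha s <= t * phi alpha a + (1 - t) * phi alpha b ->
  phi alpha0 s <= t * phi alpha0 a + (1 - t) * phi alpha0 b.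
Proof.
move=> a00; rewrite le_eqVlt => /predU1P[->//|a0a a1 t0 t1].
have a01 : alpha0 < 1 by exact: lt_le_trans a1.
set k0 := rate alpha0; have k00 : 0 < k0 by exact: rate_gt0.
rewrite !(phiE _ a01) -/k0.
move: a1; rewrite le_eqVlt => /predU1P[alpha1|a1].
  rewrite alpha1 !phi1 => H; apply: le_trans (convex_expR_mean _ _ t0 t1).
  by rewrite ler_expR; nra.
have a_gt0 : 0 < alpha by exact: lt_trans a0a.
set k := rate alpha; have k_gt0 : 0 < k by exact: rate_gt0.
have kk0 : k < k0.
  by rewrite /k /k0 /rate ltr_pdivrMr// mulrAC ltr_pdivlMr//; nra.
rewrite !(phiE _ a1) -/k => H.
pose q := k / k0.
have qk0 : q * k0 = k by rewrite /q divfK// gt_eqF.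
have q0 : 0 < q by rewrite divr_gt0.
have q1 : q < 1 by rewrite ltr_pdivrMr// mul1r.
have K x : expR (k * (x - s)) <= q * expR (k0 * (x - s)) + (1 - q).
  rewrite -qk0 -mulrA -[_ * _ in X in X <= _]addr0.
  have := convex_expR_mean (k0 * (x - s)) 0 q0 q1.
  by rewrite mulr0 expR0 mulr1.
have E x : expR (k * x) = expR (k * s) * expR (k * (x - s)).
  by rewrite -expRD; congr expR; ring.
have E0 x : expR (k0 * x) = expR (k0 * s) * expR (k0 * (x - s)).
  by rewrite -expRD; congr expR; ring.
have := expR_gt0 (k * s); have := expR_gt0 (k0 * s).
move: H; rewrite (E a) (E b) (E0 a) (E0 b); have := K a; have := K b.
set A := expR (k * (a - s)); set B := expR (k * (b - s)).
set A0 := expR (k0 * (a - s)); set B0 := expR (k0 * (b - s)).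
set X := expR (k * s); set Y := expR (k0 * s) => KB KA H Y0 X0.
have H1 : 1 <= t * A + (1 - t) * B.
  by rewrite -(ler_pM2l X0) mulr1; apply: le_trans H _; lra.
have H2 : 1 <= t * A0 + (1 - t) * B0.
  rewrite -(ler_pM2l q0); nra.
rewrite -(ler_pM2l Y0) mulr1 in H2; lra.
Qed.

End Comparison.

(** * Alpha-convexity as convexity of [phi alpha \o u], and its monotonicity in alpha *)

Section AlphaConvex.
Context {R : realType} {N : nat}.
Implicit Types (Omega : set 'rV[R]_N) (u : 'rV[R]_N -> R) (alpha : R).

Lemma alpha_convex0P Omega u :
  alpha_convex Omega 0 u <-> quasiconvex_on (closure Omega) u.
Proof.
split=> H x y cx cy.
  move=> t t0 t1; rewrite maxC.
  apply: (H x y cx cy (fun=> Num.max (u y) (u x))) => //.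
  by rewrite /segment_solution eqxx.
move=> v; rewrite /segment_solution eqxx => vE t t0 t1.
by rewrite vE// maxC; exact: H.
Qed.

Lemma alpha_convexP Omega u alpha : 0 < alpha -> alpha <= 1 ->
  alpha_convex Omega alpha u <->
  convex_on (closure Omega) (phi alpha \o u).
Proof.
move=> a0 a1; have an0 : (alpha == 0) = false by rewrite gt_eqF.
split=> H x y cx cy.
  move=> t t0 t1 /=.
  have [v vs] := classical_solution_exists (u y) (u x) a0 a1.
  rewrite -(phi_classical_solution a0 a1 vs t0 t1) ler_phi//.
  by apply: H => //; rewrite /segment_solution an0.
move=> v; rewrite /segment_solution an0 => vs t t0 t1.
rewrite -(ler_phi a0 a1) (phi_classical_solution a0 a1 vs t0 t1).
exact: H.
Qed.

Lemma alpha_convex_antitone Omega u alpha0 alpha :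
    0 <= alpha0 -> alpha0 <= alpha -> alpha <= 1 ->
  alpha_convex Omega alpha u -> alpha_convex Omega alpha0 u.
Proof.
rewrite le_eqVlt => /predU1P[<-|a00 a0a a1]; last first.
  rewrite !alpha_convexP//; do ?by [lra|exact: le_trans a1].
  by move=> H x y cx cy t t0 t1; exact: phi_mean_antitone (H _ _ cx cy _ t0 t1).
rewrite le_eqVlt => /predU1P[<-//|a0 a1].
rewrite alpha_convexP// alpha_convex0P => H x y cx cy t t0 t1.
exact: phi_mean_le_max (H _ _ cx cy _ t0 t1).
Qed.

End AlphaConvex.

(** * Strictly convex bounded domains *)

Lemma bounded_setP {R : realType} {V : normedModType R} (A : set V) :
  bounded_set A -> exists2 M : R, 0 < M & forall x, A x -> `|x| <= M.
Proof. by move=> /pinfty_ex_gt0[M M0 HM]; exists M => // x /HM. Qed.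

(** Compactness is used as a near-covering property: a statement that holds near each point of [K]
    for all small [r > 0] holds on all of [K] for a common [r]. *)
Lemma within_continuous_compact_unif {R : realType} {V : normedModType R}
    (K : set V) (g : V -> R) :
    compact K -> {within K, continuous g} ->
  forall e : R, 0 < e -> exists2 d : R, 0 < d &
    forall x y, K x -> K y -> `|x - y| < d -> `|g x - g y| < e.
Proof.
move=> cK cg e e0.
pose P (d : R) (x : V) := K x ->
  forall y, K y -> `|x - y| < d -> `|g x - g y| < e.
have /(_ R (0^'+) P) : near_covering K by apply/compact_near_coveringP.
case=> [x Kx|r /= r0 H].
  have /subspace_continuousP/(_ x Kx)/cvgrPdist_lt := cg.
  move=> /(_ (e / 2)) H; have {}H := H ltac:(lra).
  have /nbhs_ballP[d /= d0 dH] := H.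
  exists (ball x (d / 2), [set r | r < d / 2]).
    split=> /=; first by apply: nbhsx_ballx; lra.
    by apply: nbhs_right_lt; lra.
  move=> [x' r] /= [+ rd] Kx' y Ky x'y.
  rewrite -ball_normE /= => xx'.
  have gx' : `|g x - g x'| < e / 2.
    by apply: (dH x') => //; rewrite -ball_normE /=; lra.
  have gy : `|g x - g y| < e / 2.
    apply: (dH y) => //; rewrite -ball_normE /=.
    by have := ler_distD x' x y; lra.
  by have := ler_distD (g x) (g x') (g y); rewrite (distrC (g x') (g x)); lra.
exists (r / 2) => [|x y Kx Ky xy]; first by rewrite divr_gt0.
apply: (H (r / 2)) => //=; last by rewrite divr_gt0.
by rewrite sub0r normrN gtr0_norm ?divr_gt0//; lra.
Qed.

(** Two coordinate vectors under the sup-norm. This is where [N >= 2] enters: [e1] gives vectors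
    longer than the diameter of the domain, and the pair gives a path of nonzero vectors from a
    vector to its opposite. *)
Lemma rV_two_directions {R : realType} N : (2 <= N)%N ->
  exists e1 e2 : 'rV[R]_N, [/\ `|e1| <= 1, `|e2| <= 1 &
    forall a b : R, `|a| <= `|a *: e1 + b *: e2| /\ `|b| <= `|a *: e1 + b *: e2|].
Proof.
case: N => [|[|N]]// _.
have le1 (i : 'I_N.+2) : `|delta_mx 0 i : 'rV[R]_N.+2| <= 1.
  rewrite [leLHS]/Num.Def.normr /= mx_normrE; apply/bigmax_le => // -[j l] _ /=.
  by rewrite mxE; case: (_ && _); rewrite ?normr1 ?normr0.
have coord (v : 'rV[R]_N.+2) i : `|v 0 i| <= `|v|.
  rewrite [leRHS]/Num.Def.normr /= mx_normrE.
  by apply: (le_bigmax _ (fun j : 'I_1 * 'I_N.+2 => `|v j.1 j.2|) (0, i)).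
exists (delta_mx 0 0), (delta_mx 0 1); split => // a b; split.
  by apply: le_trans (coord _ 0); rewrite !mxE /= mulr1 mulr0 addr0.
by apply: le_trans (coord _ 1); rewrite !mxE /= mulr1 mulr0 add0r.
Qed.

Section Domain.
Context {R : realType} {N : nat} (Omega : set 'rV[R]_N).
Context (hdom : bounded_domain Omega) (hconv : strictly_convex Omega).
Implicit Types x y z d : 'rV[R]_N.

Let oOmega : open Omega. Proof. by case: hdom. Qed.

Lemma boundaryE z : boundary Omega z <-> closure Omega z /\ ~ Omega z.
Proof. by rewrite /boundary ((interior_id Omega).1 oOmega). Qed.

Lemma closure_domain_bounded :
  exists2 M : R, 0 < M & forall x, closure Omega x -> `|x| <= M.
Proof.
have [_ _ _ /bounded_setP[M M0 H]] := hdom.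
exists M => // x /closure_normP cx; apply/ler_addgt0Pr => e /cx[a /H aM xa].
by have := ler_distD a x 0; rewrite !subr0; lra.
Qed.

Lemma compact_closure_domain : compact (closure Omega).
Proof.
apply: bounded_closed_compact; last exact: closed_closure.
have [M M0 H] := closure_domain_bounded.
exists M; split=> [|r Mr x /= /H xM]; first exact: num_real.
by rewrite (le_trans xM)// ltW.
Qed.

Lemma compact_boundary_domain : compact (boundary Omega).
Proof.
apply: compact_closedI compact_closure_domain _.
by apply: open_closedC; exact: open_interior.
Qed.

Lemma closure_convex x y (t : R) : closure Omega x -> closure Omega y ->
  0 < t -> t < 1 -> closure Omega (t *: x + (1 - t) *: y).
Proof.
move=> cx cy t0 t1; have [<-|xy] := eqVneq x y.
  by rewrite -scalerDl subrKC scale1r.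
by apply: subset_closure; exact: hconv.
Qed.

Lemma domain_convex x y (t : R) : Omega x -> closure Omega y ->
  0 < t -> t < 1 -> Omega (t *: x + (1 - t) *: y).
Proof.
move=> ox cy t0 t1; have [<-|xy] := eqVneq x y.
  by rewrite -scalerDl subrKC scale1r.
by apply: hconv => //; exact: subset_closure.
Qed.

(** Take the last parameter [s] in [[0, 1]] whose point is in the closure. If that point were in the
    open set [Omega], then [s < 1] because [z + d] is outside, and [s] could be increased. *)
Lemma exit_boundary z d : closure Omega z -> ~ Omega (z + d) ->
  exists s : R, [/\ 0 <= s, s <= 1 & boundary Omega (z + s *: d)].
Proof.
move=> cz nzd.
pose S := [set s : R | [/\ 0 <= s, s <= 1 & closure Omega (z + s *: d)]].
have S0 : S 0 by split => //; rewrite scale0r addr0.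
have uS : has_ubound S by exists 1 => s [].
have ubS := ub_le_sup uS.
set s := sup S in ubS *.
have s0 : 0 <= s by exact: ubS.
have s1 : s <= 1 by apply: ge_sup; [exists 0|move=> ? []].
(* Adding 1 keeps the divisor positive when [d = 0]. *)
have D0 : 0 < `|d| + 1 by rewrite ltr_pwDr.
have cs : closure Omega (z + s *: d).
  apply/closure_normP => e e0.
  have e20 : 0 < e / 2 by rewrite divr_gt0.
  have [] := @sup_adherent _ S (e / 2 / (`|d| + 1)).
  - by rewrite divr_gt0.
  - by split => //; exists 0.
  move=> r Sr; rewrite -/s => sr; have rs := ubS r Sr.
  have [_ _ /closure_normP/(_ _ e20)[a Oa ra]] := Sr.
  exists a => //; apply: le_lt_trans (ler_distD (z + r *: d) _ _) _.
  have -> : z + s *: d - (z + r *: d) = (s - r) *: d.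
    by rewrite opprD addrACA subrr add0r scalerBl.
  rewrite normrZ ger0_norm ?subr_ge0//.
  suff : (s - r) * `|d| < e / 2 by lra.
  have : (s - r) * (`|d| + 1) < e / 2 by rewrite -ltr_pdivlMr//; lra.
  by have := normr_ge0 d; nra.
exists s; split => //; apply/boundaryE; split => // os.
have [e e0 eO] := open_normP oOmega os.
have sn1 : s < 1.
  rewrite lt_neqAle s1 andbT; apply: contra_notN nzd => /eqP s1'.
  by move: os; rewrite s1' scale1r.
pose h := Num.min (1 - s) (e / 2 / (`|d| + 1)).
have h0 : 0 < h by rewrite lt_min subr_gt0 sn1 !divr_gt0.
have h1 : h <= 1 - s by rewrite ge_min lexx.
have h2 : h * (`|d| + 1) <= e / 2.
  by rewrite -ler_pdivlMr// ge_min lexx orbT.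
suff : s + h <= s by lra.
apply: ubS; split; [lra|lra|apply: subset_closure; apply: eO].
rewrite scalerDl addrA opprD addrA subrr add0r normrN normrZ gtr0_norm//.
by have := normr_ge0 d; nra.
Qed.

(** Leaving [Omega] from [y] along [d] and along [- d] gives two boundary points with [y] strictly
    between them; quasiconvexity on this chord gives the bound. *)
Lemma short_chord y d : Omega y -> ~ Omega (y + d) -> ~ Omega (y - d) ->
  exists a b, [/\ boundary Omega a, boundary Omega b,
    `|a - y| <= `|d|, `|b - y| <= `|d| &
    forall u, quasiconvex_on (closure Omega) u -> u y <= Num.max (u a) (u b)].
Proof.
move=> oy ny1 ny2; have cy := subset_closure oy.
have [s [s0 s1 bs]] := exit_boundary cy ny1.
have [r [r0 r1 br]] := exit_boundary cy ny2.
have pos (c : R) (d' : 'rV[R]_N) :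
    0 <= c -> boundary Omega (y + c *: d') -> 0 < c.
  move=> c0 /boundaryE[_ nb]; rewrite lt_neqAle c0 andbT.
  by apply: contra_notN nb => /eqP <-; rewrite scale0r addr0.
have {}s0 := pos _ _ s0 bs; have {}r0 := pos _ _ r0 br.
exists (y + s *: d), (y + r *: - d); split => //.
- by rewrite addrC addKr normrZ gtr0_norm// ler_piMl.
- by rewrite addrC addKr normrZ normrN gtr0_norm// ler_piMl.
move=> u qu; have [ca _] := (boundaryE _).1 bs; have [cb _] := (boundaryE _).1 br.
(* With this weight the combination of [y + s d] and [y - r d] is [y]. *)
have := qu _ _ ca cb (r / (r + s)).
rewrite divr_gt0 ?addr_gt0// ltr_pdivrMr ?addr_gt0// mul1r ltrDl => /(_ isT s0).
rewrite (_ : _ *: _ + _ = y)// !scalerDr addrACA -scalerDl subrKC scale1r.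
rewrite !scalerA scalerN -scalerBl (_ : _ - _ = 0) ?scale0r ?addr0//.
by field; rewrite gt_eqF ?addr_gt0.
Qed.

(** Uniform form of strict convexity, by compactness of the set of pairs of points of the
    closure. *)
Lemma convexity_modulus (e : R) : 0 < e -> exists2 k : R, 0 < k &
  forall x y, closure Omega x -> closure Omega y -> e <= `|x - y| ->
  forall w, `|2^-1 *: (x + y) - w| < k -> Omega w.
Proof.
move=> e0.
pose P (r : R) (p : 'rV[R]_N * 'rV[R]_N) := e <= `|p.1 - p.2| ->
  forall w, `|2^-1 *: (p.1 + p.2) - w| < r -> Omega w.
have /compact_near_coveringP/(_ R (0^'+) P) :=
  compact_setX compact_closure_domain compact_closure_domain.
case=> [[x y] [/= cx cy]|r /= r0 H]; last first.
  exists (r / 2) => [|x y cx cy]; first by rewrite divr_gt0.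
  apply: (H (r / 2) _ _ (x, y)) => //=; last by rewrite divr_gt0.
  by rewrite sub0r normrN gtr0_norm ?divr_gt0//; lra.
have near_pair (d s : R) : 0 < d -> 0 < s ->
    (forall x' y' r, `|x - x'| < d -> `|y - y'| < d -> r < s -> P r (x', y')) ->
    \forall x' \near (x, y) & i \near 0^'+, P i x'.
  move=> d0 s0 H; exists (ball x d `*` ball y d, [set r | r < s]) => /=.
    split; last exact: nbhs_right_lt.
    by exists (ball x d, ball y d) => /=; [split; exact: nbhsx_ballx|].
  by move=> [[x' y'] r] /= [[]]; rewrite -!ball_normE /= => *; exact: H.
(* Pairs at distance less than [e] have only such pairs nearby, where the claim is vacuous. *)
have [exy|xye] := leP e `|x - y|; last first.
  apply: (near_pair ((e - `|x - y|) / 2) 1) => //.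
    by rewrite divr_gt0// subr_gt0.
  move=> x' y' r xx' yy' _ /= ex'y'.
  have := ler_distD x x' y'; have := ler_distD y x y'.
  by rewrite (distrC x' x); lra.
have oxy : Omega (2^-1 *: (x + y)).
  rewrite scalerDr -[X in _ + X *: _](_ : 1 - 2^-1 = 2^-1); last by field.
  apply: hconv => //; [|lra].
  by rewrite -subr_eq0 -normr_gt0; exact: lt_le_trans exy.
have [d d0 dO] := open_normP oOmega oxy.
apply: (near_pair (d / 2) (d / 2)); [by rewrite divr_gt0|by rewrite divr_gt0|].
move=> x' y' r xx' yy' rd /= _ w wr; apply: dO.
apply: le_lt_trans (ler_distD (2^-1 *: (x' + y')) _ _) _.
rewrite -scalerBr opprD addrACA normrZ gtr0_norm ?invr_gt0//.
by have := ler_normD (x - x') (y - y'); lra.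
Qed.

End Domain.

(** * Perturbation of the exponent *)

Section Generators.
Context {R : realType}.
Implicit Types (a b c d e k s t alpha : R).

Lemma norm_expR_sub1 s : `|expR s - 1| <= expR `|s| - 1.
Proof.
have [s0|s0] := leP 0 s.
  by rewrite (ger0_norm s0) ger0_norm// subr_ge0 -expR0 ler_expR.
rewrite (ltr0_norm s0) ltr0_norm ?subr_lt0 ?expR_lt1// opprB.
have := expR_ge1Dx s; have := expR_ge1Dx (- s); lra.
Qed.

(** For [alpha < 1] the increment [exp (k s) (1 - exp (- k e))] is smallest at [s = - M]. Lowering
    [phi alpha] by [h] thus costs at most [e] in the argument. *)
Lemma phi_gap alpha (M e : R) : 0 < alpha -> alpha <= 1 -> 0 < e ->
  exists2 h, 0 < h &
    forall s, `|s| <= M -> phi alpha (s - e) + h <= phi alpha s.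
Proof.
move=> a0; rewrite le_eqVlt => /predU1P[->|a1] e0.
  by exists e => // s _; rewrite !phi1 subrK.
set k := rate alpha; have k0 : 0 < k by exact: rate_gt0.
have E1 : 0 < 1 - expR (- (k * e)) by rewrite subr_gt0 expR_lt1 oppr_lt0 mulr_gt0.
exists (expR (- (k * M)) * (1 - expR (- (k * e)))).
  by rewrite mulr_gt0// expR_gt0.
move=> s /ler_normlP[sM _]; rewrite !phiE// -/k mulrBr expRD.
have : expR (- (k * M)) <= expR (k * s) by rewrite ler_expR; nra.
move=> H; have := ler_wpM2r (ltW E1) H; lra.
Qed.

(* Only [phi alpha] up to an increasing affine change matters for convexity,
   and for [alpha0 = 1] the normalization [(expR (k s) - 1) / k] is the one
   that converges. *)
Lemma phi_close alpha0 (L e : R) : 0 < alpha0 -> alpha0 <= 1 -> 0 < L -> 0 < e ->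
  exists2 h, 0 < h & forall alpha, alpha <= 1 -> `|alpha - alpha0| < h ->
    0 < alpha /\ exists c d, 0 < c /\
      forall s, `|s| <= L -> `|c * phi alpha s + d - phi alpha0 s| <= e.
Proof.
move=> a00; rewrite le_eqVlt => /predU1P[->|a01] L0 e0.
  have h10 : 0 < 4^-1 / L by rewrite divr_gt0 ?invr_gt0.
  have h20 : 0 < e / (4 * L ^+ 2) by rewrite divr_gt0 ?mulr_gt0 ?exprn_gt0.
  (* The three bounds on [1 - alpha] give in turn [k <= 2 (1 - alpha)], [k L <= 1 / 2] and
     [2 k L ^ 2 <= e]. *)
  exists (Num.min 2^-1 (Num.min (4^-1 / L) (e / (4 * L ^+ 2)))).
    by rewrite !lt_min invr_gt0 ltr0n h10 h20.
  move=> alpha; rewrite le_eqVlt => /predU1P[-> _|a1].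
    split=> //; exists 1, 0; split=> // s _.
    by rewrite mul1r addr0 subrr normr0 ltW.
  rewrite ltr0_norm ?subr_lt0// opprB !lt_min => /and3P[h1 h2 h3].
  have a0 : 0 < alpha by lra.
  split=> //; set k := rate alpha; have k0 : 0 < k by exact: rate_gt0.
  have kh : k <= 2 * (1 - alpha).
    by rewrite /k /rate ler_pdivrMr//; nra.
  exists k^-1, (- k^-1); split; first by rewrite invr_gt0.
  move=> s sL; rewrite phi1 phiE// -/k.
  set x := k * s.
  have kL : k * L <= 2^-1.
    by move: h2; rewrite ltr_pdivlMr//; nra.
  have xn : `|x| <= 2^-1.
    by rewrite normrM gtr0_norm//; apply: le_trans kL; rewrite ler_pM2l.
  have x1 : x <= 2^-1 by exact: le_trans (ler_norm _) xn.
  have lo := expR_ge1Dx x.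
  (* From [expR x <= 1 / (1 - x)] and [(1 + x + 2 x ^ 2) (1 - x) = 1 + x ^ 2 (1 - 2 x) >= 1]. *)
  have up : expR x <= 1 + x + 2 * x ^+ 2.
    have : expR x * (1 - x) <= 1.
      have := expR_ge1Dx (- x); rewrite expRN => H.
      have := ler_wpM2l (expR_ge0 x) H; rewrite divff ?gt_eqF ?expR_gt0//.
    move=> H; rewrite -(@ler_pM2r _ (1 - x)); last by lra.
    apply: le_trans H _; have := sqr_ge0 x; nra.
  have -> : k^-1 * expR x - k^-1 - s = k^-1 * (expR x - 1 - x).
    by rewrite /x; field; rewrite gt_eqF.
  rewrite normrM gtr0_norm ?invr_gt0// ler_pdivrMl//.
  rewrite ger0_norm; last by lra.
  apply: (@le_trans _ _ (2 * x ^+ 2)); first by lra.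
  have s2 : s ^+ 2 <= L ^+ 2.
    by rewrite -(real_normK (num_real s)) ler_pXn2r ?nnegrE// ltW.
  have kL2 : k * (2 * L ^+ 2) <= e.
    move: h3; rewrite ltr_pdivlMr ?mulr_gt0 ?exprn_gt0//.
    have := exprn_gt0 2 L0; nra.
  rewrite /x exprMn (_ : 2 * _ = k * (k * (2 * s ^+ 2))); last by ring.
  rewrite ler_pM2l//; apply: le_trans kL2; rewrite ler_pM2l//; lra.
set k0 := rate alpha0; have k00 : 0 < k0 by exact: rate_gt0.
set X := expR (k0 * L); have X0 : 0 < X by exact: expR_gt0.
have r1 : 1 < 1 + e / X by rewrite ltrDl divr_gt0.
(* Chosen so that [exp (r L) - 1 = e / X], the relative error allowed when the rates differ by at
   most [r]. *)
set r := ln (1 + e / X) / L.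
have r0 : 0 < r by rewrite divr_gt0// ln_gt0.
have h30 : 0 < r * alpha0 ^+ 2 / 2.
  by apply: divr_gt0 => //; apply: mulr_gt0 => //; exact: exprn_gt0.
(* These bounds give [alpha > alpha0 / 2], [alpha < 1] and, as [k - k0 = (alpha0 - alpha) / (alpha
   alpha0)], a rate difference of at most [r]. *)
exists (Num.min (alpha0 / 2) (Num.min (1 - alpha0) (r * alpha0 ^+ 2 / 2))).
  by rewrite !lt_min h30 subr_gt0 a01 divr_gt0.
move=> alpha _; rewrite !lt_min => /and3P[h1 h2 h3].
have := ler_norm (alpha - alpha0).
have := ler_norm (alpha0 - alpha); rewrite distrC => n1 n2.
have a0 : 0 < alpha by lra.
have a1 : alpha < 1 by lra.
split=> //; exists 1, 0; split=> // s sL; rewrite mul1r addr0 !phiE// -/k0.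
set k := rate alpha.
have kr : `|k - k0| <= r.
  have -> : k - k0 = (alpha0 - alpha) / (alpha * alpha0).
    by rewrite /k /k0 /rate; field; rewrite !gt_eqF.
  rewrite normrM distrC normfV (gtr0_norm (mulr_gt0 _ _))//.
  rewrite ler_pdivrMr ?mulr_gt0//; nra.
have -> : expR (k * s) - expR (k0 * s)
    = expR (k0 * s) * (expR ((k - k0) * s) - 1).
  by rewrite mulrBr mulr1 -expRD; congr (expR _ - _); ring.
rewrite normrM gtr0_norm ?expR_gt0//.
apply: (@le_trans _ _ (X * (e / X))); last by rewrite mulrC divfK// gt_eqF.
apply: ler_pM; [exact: expR_ge0|exact: normr_ge0| |].
  by rewrite ler_expR ler_pM2l//; exact: le_trans (ler_norm _) sL.
apply: le_trans (norm_expR_sub1 _) _; rewrite lerBlDl.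
rewrite -[leRHS]lnK ?posrE; last by lra.
rewrite ler_expR normrM; apply: (@le_trans _ _ (r * L)).
  by apply: ler_pM.
by rewrite /r divfK// gt_eqF.
Qed.

(** Solve [phi2 (w x) = phi1 (v x) - h] by the intermediate value theorem on [[v x - e, v x]]: the
    shift by [h] puts the target below [phi2 (v x)], and the gap [2 h] puts it above
    [phi2 (v x - e)]. A constant shift preserves convexity. *)
Lemma generator_transfer {V : lmodType R} (D : set V) (phi1 phi2 : R -> R)
    (v : V -> R) (M e h : R) :
    (forall x y, D x -> D y -> forall t, 0 < t -> t < 1 ->
       D (t *: x + (1 - t) *: y)) ->
    continuous phi2 -> convex_on D (phi1 \o v) -> 0 < e ->
    (forall x, D x -> `|v x| <= M) ->
    (forall s, `|s| <= M -> `|phi1 s - phi2 s| <= h) ->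
    (forall s, `|s| <= M -> phi2 (s - e) + 2 * h <= phi2 s) ->
  exists w : V -> R, convex_on D (phi2 \o w) /\
    forall x, D x -> v x - e <= w x /\ w x <= v x.
Proof.
move=> cD cphi cv e0 vM close gap.
have /choice[w wE] : forall x, exists y, D x ->
    [/\ v x - e <= y, y <= v x & phi2 y = phi1 (v x) - h].
  move=> x; have [Dx|nDx] := pselect (D x); last by exists 0.
  have := close _ (vM x Dx); rewrite ler_norml => /andP[c1 c2].
  have := gap _ (vM x Dx) => g1.
  have [|||y + yE] := @IVT R phi2 (v x - e) (v x) (phi1 (v x) - h).
  - by rewrite gerBl ltW.
  - exact: continuous_subspaceT.
  - by rewrite ge_min le_max; apply/andP; split; apply/orP; [left|right]; lra.
  by rewrite in_itv /= => /andP[y1 y2]; exists y.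
exists w; split=> [x y Dx Dy t t0 t1 /=|x /wE[]//].
have [_ _ ->] := wE _ (cD _ _ Dx Dy t t0 t1).
have [_ _ ->] := wE _ Dx; have [_ _ ->] := wE _ Dy.
by have := cv x y Dx Dy t t0 t1; rewrite /=; lra.
Qed.

Lemma convex_on_affine {V : lmodType R} (D : set V) (f : V -> R) c d :
  0 < c -> convex_on D (fun x => c * f x + d) <-> convex_on D f.
Proof.
move=> c0; split=> H x y Dx Dy t t0 t1; have := H x y Dx Dy t t0 t1.
  by move=> K; rewrite -(ler_pM2l c0); lra.
by move=> /(ler_wpM2l (ltW c0)); lra.
Qed.

Lemma convex_on_max {V : lmodType R} (D : set V) (f : V -> R) c :
  convex_on D f -> convex_on D (fun x => Num.max (f x) c).
Proof.
move=> H x y Dx Dy t t0 t1; rewrite ge_max; apply/andP; split.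
  apply: le_trans (H x y Dx Dy t t0 t1) _.
  by apply: lerD; rewrite ler_pM2l ?subr_gt0// le_max lexx.
have : c <= Num.max (f x) c by rewrite le_max lexx orbT.
have : c <= Num.max (f y) c by rewrite le_max lexx orbT.
nra.
Qed.

End Generators.

(** * Envelopes *)

Section Envelope.
Context {R : realType} {N : nat} (hN : (2 <= N)%N) (Omega : set 'rV[R]_N).
Context (hdom : bounded_domain Omega) (hconv : strictly_convex Omega).
Context (g : 'rV[R]_N -> R) (hg : {within boundary Omega, continuous g}).
Context (M : R) (M_gt0 : 0 < M) (gM : forall z, boundary Omega z -> `|g z| <= M).
Implicit Types (x y z d : 'rV[R]_N) (u v w : 'rV[R]_N -> R) (alpha e : R).

Local Notation env := (alpha_envelope Omega g).
Local Notation competitor := (envelope_competitor Omega g).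

Lemma g_le z : boundary Omega z -> g z <= M.
Proof. by move=> /gM; exact/le_trans/ler_norm. Qed.

Lemma le_g z : boundary Omega z -> - M <= g z.
Proof. by move=> /gM; rewrite ler_norml => /andP[]. Qed.

(** Maximum principle: each interior point lies on a chord with both ends on the boundary. *)
Lemma quasiconvex_le_boundary u (c : R) :
    quasiconvex_on (closure Omega) u ->
    (forall z, boundary Omega z -> u z <= c) ->
  forall z, closure Omega z -> u z <= c.
Proof.
move=> qu uc z cz; have [oz|noz] := pselect (Omega z); last first.
  by apply: uc; apply/(boundaryE hdom).
have [B B0 HB] := closure_domain_bounded hdom.
have [e1 [e2 [_ _ /(_ (2 * B + 1) 0)[+ _]]]] := rV_two_directions (R := R) hN.
(* The length [2 * B + 1] exceeds the diameter, so [z + d] and [z - d] are both outside. *)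
rewrite scale0r addr0 ger0_norm; last by lra.
set d := _ *: e1 => dB.
have zB := HB z cz.
have [||a [b [ba bb _ _ /(_ u qu)]]] := @short_chord _ _ _ hdom z d oz.
- move=> /subset_closure/HB; have := ler_normB (z + d) z.
  by rewrite addrC addKr; lra.
- move=> /subset_closure/HB; have := ler_normB z (z - d).
  by rewrite opprB subrKC; lra.
by move=> /le_trans; apply; rewrite ge_max !uc.
Qed.

Lemma alpha_convex_quasiconvex alpha v : 0 <= alpha -> alpha <= 1 ->
  alpha_convex Omega alpha v -> quasiconvex_on (closure Omega) v.
Proof.
by move=> a0 a1 av; apply/alpha_convex0P; exact: alpha_convex_antitone av.
Qed.

Lemma competitor_le alpha v z : 0 <= alpha -> alpha <= 1 ->
  competitor alpha v -> closure Omega z -> v z <= M.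
Proof.
move=> a0 a1 [av vg]; apply: quasiconvex_le_boundary.
  exact: alpha_convex_quasiconvex av.
by move=> y yb; exact: le_trans (vg y yb) (g_le yb).
Qed.

Lemma cst_competitor alpha (c : R) : 0 <= alpha -> alpha <= 1 ->
  (forall z, boundary Omega z -> c <= g z) -> competitor alpha (cst c).
Proof.
move=> a0 a1 cg; split => //.
move: a0; rewrite le_eqVlt => /predU1P[<-|a0].
  by apply/alpha_convex0P => x y _ _ t _ _; rewrite maxxx.
by apply/alpha_convexP => // x y _ _ t _ _; rewrite -mulrDl subrKC mul1r.
Qed.

(** The maximum principle bounds the set of values by [M], so its [sup] is an upper bound. *)
Lemma le_envelope alpha v z : 0 <= alpha -> alpha <= 1 ->
  competitor alpha v -> closure Omega z -> v z <= env alpha z.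
Proof.
move=> a0 a1 cv cz; apply: ub_le_sup; last by exists v.
by exists M => _ [w cw <-]; exact: competitor_le cw cz.
Qed.

(** The constant [- M] is a competitor, so the set of values is nonempty and [sup] is the least
    upper bound. *)
Lemma envelope_le alpha (c : R) z : 0 <= alpha -> alpha <= 1 ->
  (forall v, competitor alpha v -> v z <= c) -> env alpha z <= c.
Proof.
move=> a0 a1 H; apply: ge_sup; last by move=> _ [v cv <-]; exact: H.
by exists (- M); exists (cst (- M)) => //; apply: cst_competitor => // y /le_g.
Qed.

Lemma envelope_antitone alpha0 alpha z :
    0 <= alpha0 -> alpha0 <= alpha -> alpha <= 1 -> closure Omega z ->
  env alpha z <= env alpha0 z.
Proof.
move=> a0 aa a1 cz; apply: envelope_le => //; first exact: le_trans aa.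
move=> v [av vg]; apply: le_envelope => //; first exact: le_trans a1.
by split => //; exact: alpha_convex_antitone av.
Qed.

Lemma envelope_near alpha0 e : 0 < alpha0 -> alpha0 <= 1 -> 0 < e ->
  exists2 h : R, 0 < h & forall alpha, 0 <= alpha -> alpha <= 1 ->
    `|alpha - alpha0| < h ->
    forall z, closure Omega z -> `|env alpha z - env alpha0 z| <= e.
Proof.
move=> a00 a01 e0.
have [k k0 gap] := phi_gap M a00 a01 e0.
(* An error of [k / 4] at both [s] and [s - e] leaves a gap of [k / 2], twice the error. Closeness
   is asked up to [M + e] because [s - e] occurs. *)
have k40 : 0 < k / 4 by rewrite divr_gt0.
have Me0 : 0 < M + e by rewrite addr_gt0.
have [h h0 close] := phi_close a00 a01 Me0 k40.
exists h => // alpha _ a1 ah z cz.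
have [a0 [c [d [c0 cd]]]] := close alpha a1 ah.
(* An increasing affine change of [phi alpha]: it defines the same convexity and is close to
   [phi alpha0]. *)
pose psi s := c * phi alpha s + d.
have cD x y : closure Omega x -> closure Omega y -> forall t : R,
    0 < t -> t < 1 -> closure Omega (t *: x + (1 - t) *: y).
  by move=> cx cy t t0 t1; exact: closure_convex.
(* Competitors have no lower bound of their own. Truncation at [- M] only raises them and keeps them
   below [g] on the boundary. *)
have bound v : (forall x, closure Omega x -> v x <= M) ->
    forall x, closure Omega x -> `|Num.max (v x) (- M)| <= M.
  move=> vM x cx; rewrite ler_norml le_max lexx orbT ge_max vM//=.
  by rewrite lerNl (le_trans _ (ltW M_gt0))// oppr_le0 ltW.
have cpsi : continuous psi.
  move=> s; apply: cvgD; last exact: cvg_cst.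
  by apply: cvgM; [exact: cvg_cst|exact: continuous_phi].
have closeM s : `|s| <= M -> `|psi s - phi alpha0 s| <= k / 4.
  by move=> sM; apply: cd; rewrite (le_trans sM)// lerDl ltW.
have closeMe s : `|s| <= M -> `|psi (s - e) - phi alpha0 (s - e)| <= k / 4.
  move=> sM; apply: cd; apply: le_trans (ler_normB _ _) _.
  by rewrite lerD// gtr0_norm.
have mono_phi alpha' v : 0 < alpha' -> alpha' <= 1 -> competitor alpha' v ->
    convex_on (closure Omega) (fun x => phi alpha' (Num.max (v x) (- M))).
  move=> a'0 a'1 [/alpha_convexP -/(_ a'0 a'1) av _].
  have -> : (fun x => phi alpha' (Num.max (v x) (- M))) =
            (fun x => Num.max (phi alpha' (v x)) (phi alpha' (- M))).
    apply/funext => x; have [vx|vx] := leP (v x) (- M).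
      by rewrite max_r// ler_phi.
    by rewrite max_l// ler_phi// ltW.
  exact: convex_on_max.
rewrite ler_norml; apply/andP; split.
(* A competitor for [alpha0] is transferred to [alpha]. *)
- rewrite lerBrDr addrC lerBlDr; apply: envelope_le => //; first exact: ltW.
  move=> v cv; have vM x := competitor_le (ltW a00) a01 cv (z := x).
  have [|||w [cw vw]] := @generator_transfer _ _ (closure Omega)
    (phi alpha0) psi (fun x => Num.max (v x) (- M)) M e (k / 4) cD cpsi
    (mono_phi _ _ a00 a01 cv) e0.
  + exact: bound.
  + by move=> s sM; rewrite distrC closeM.
  + move=> s sM; have := gap s sM; have := closeM s sM; have := closeMe s sM.
    by rewrite !ler_norml => /andP[? ?] /andP[? ?] ?; lra.
  have wle : w z <= env alpha z.
    apply: le_envelope => //; first exact: ltW.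
    split; first by apply/alpha_convexP => //; apply/(convex_on_affine _ _ d c0).
    move=> x xb; have [cx _] := (boundaryE hdom x).1 xb.
    have [_ /le_trans] := vw x cx; apply.
    by rewrite ge_max le_g// andbT; have [_] := cv; apply.
  have [+ _] := vw z cz; have : v z <= Num.max (v z) (- M) by rewrite le_max lexx.
  lra.
(* Conversely, a competitor for [alpha] is transferred to [alpha0]. *)
- rewrite lerBlDr; apply: envelope_le => //; first exact: ltW.
  move=> v cv; have vM x := competitor_le (ltW a0) a1 cv (z := x).
  have [|||w [cw vw]] := @generator_transfer _ _ (closure Omega)
    psi (phi alpha0) (fun x => Num.max (v x) (- M)) M e (k / 4) cD
    (@continuous_phi _ _) ((convex_on_affine _ _ d c0).2 (mono_phi _ _ a0 a1 cv)) e0.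
  + exact: bound.
  + exact: closeM.
  + by move=> s sM; have := gap s sM; lra.
  have wle : w z <= env alpha0 z.
    apply: le_envelope => //; first exact: ltW.
    split; first by apply/alpha_convexP.
    move=> x xb; have [cx _] := (boundaryE hdom x).1 xb.
    have [_ /le_trans] := vw x cx; apply.
    by rewrite ge_max le_g// andbT; have [_] := cv; apply.
  have [+ _] := vw z cz; have : v z <= Num.max (v z) (- M) by rewrite le_max lexx.
  lra.
Qed.

Lemma envelope0_quasiconvex : quasiconvex_on (closure Omega) (env 0).
Proof.
move=> x y cx cy t t0 t1; apply: envelope_le => // v cv.
have [/alpha_convex0P qv _] := cv.
apply: le_trans (qv x y cx cy t t0 t1) _; rewrite ge_max !le_max.
by rewrite !(le_envelope _ _ cv)// orbT.
Qed.

Lemma envelope_le_boundary alpha z : 0 <= alpha -> alpha <= 1 ->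
  boundary Omega z -> env alpha z <= g z.
Proof. by move=> a0 a1 bz; apply: envelope_le => // v [_]; apply. Qed.

Lemma le_envelopeN alpha z : 0 <= alpha -> alpha <= 1 ->
  closure Omega z -> - M <= env alpha z.
Proof.
move=> a0 a1; apply: (@le_envelope alpha (cst (- M))) => //.
by apply: cst_competitor => // y /le_g.
Qed.

End Envelope.

(** * The quasiconvex envelope and the limit alpha -> 0 *)

Section QuasiconvexEnvelope.
Context {R : realType} {N : nat} (hN : (2 <= N)%N) (Omega : set 'rV[R]_N).
Context (hdom : bounded_domain Omega) (hconv : strictly_convex Omega).
Context (g : 'rV[R]_N -> R) (hg : {within boundary Omega, continuous g}).
Context (M : R) (M_gt0 : 0 < M) (gM : forall z, boundary Omega z -> `|g z| <= M).
Implicit Types (x y z d : 'rV[R]_N) (u v w : 'rV[R]_N -> R) (alpha e : R).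

Local Notation env := (alpha_envelope Omega g).
Local Notation competitor := (envelope_competitor Omega g).

Let le_env0 v z : competitor 0 v -> closure Omega z -> v z <= env 0 z.
Proof. exact: (le_envelope hN hdom gM (lexx (0 : R)) ler01). Qed.

Let env0_qc : quasiconvex_on (closure Omega) (env 0).
Proof. exact: (envelope0_quasiconvex hN hdom gM). Qed.

Let env0_le z : boundary Omega z -> env 0 z <= g z.
Proof. exact: (envelope_le_boundary gM (lexx (0 : R)) ler01). Qed.

(* Rotating a short segment centred at [y], the distances of its two ends to
   the closed domain become equal; if both ends were in the closed domain, a
   whole ball around their midpoint [y] would lie in [Omega]. *)
Lemma short_exit_direction y (r k : R) : Omega y -> 0 < r ->
    (forall p q, closure Omega p -> closure Omega q -> r <= `|p - q| ->
       forall w : 'rV[R]_N, `|2^-1 *: (p + q) - w| < k -> Omega w) ->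
    (exists2 x, ~ Omega x & `|y - x| < k) ->
  exists d, [/\ `|d| <= r, ~ Omega (y + d) & ~ Omega (y - d)].
Proof.
move=> oy r0 modk [x nox yx].
have [e1 [e2 [e11 e21 He]]] := rV_two_directions (R := R) hN.
(* This path runs from [- r e1] to [r e1] through vectors of length between [r / 2] and [r]. As its
   ends are opposite, [f] takes opposite values there and vanishes in between. *)
pose d (t : R) := r *: (t *: e1 + (1 - `|t|) *: e2).
have C0 : closure Omega !=set0 by exists y; exact: subset_closure.
pose D := dist (closure Omega).
pose f t := D (y + d t) - D (y - d t).
have cd : continuous d.
  move=> t; apply: cvgZl_tmp; apply: cvgD; apply: cvgZr_tmp; first exact: cvg_id.
  by apply: cvgB; [exact: cvg_cst|exact: norm_continuous].
have cf : continuous f.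
  move=> t; apply: cvgB.
    apply: (@continuous_comp _ _ _ (fun t => y + d t) D).
      by apply: cvgD; [exact: cvg_cst|exact: cd].
    exact: dist_continuous.
  apply: (@continuous_comp _ _ _ (fun t => y - d t) D).
    by apply: cvgB; [exact: cvg_cst|exact: cd].
  exact: dist_continuous.
have dN : d (- 1) = - d 1.
  by rewrite /d normrN normr1 subrr !scale0r !addr0 scaleN1r scalerN scale1r.
have fN : f (- 1) = - f 1 by rewrite /f dN (opprK (d 1)) opprB.
have [|||t] := @IVT R f (-1) 1 0.
- exact: le_trans (lerN10 _) ler01.
- exact: continuous_subspaceT.
- rewrite fN; move: (f 1) => c; rewrite ge_min le_max oppr_le0 oppr_ge0.
  by case: (leP 0 c) => [_|/ltW ->]; rewrite ?orbT.
rewrite in_itv /= => /andP[t1 t2] /eqP; rewrite subr_eq0 => /eqP Dt.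
have [Ht1 Ht2] := He t (1 - `|t|).
have tn : `|t| <= 1 by rewrite ler_norml t1 t2.
have dlo : r <= 2 * `|d t|.
  rewrite normrZ gtr0_norm//; move: Ht1 Ht2.
  set q := `|_ + _|; rewrite (ger0_norm (_ : 0 <= 1 - `|t|)) ?subr_ge0// => *; nra.
have dhi : `|d t| <= r.
  rewrite normrZ gtr0_norm// ler_piMr// ?(ltW r0)//.
  apply: le_trans (ler_normD _ _) _.
  rewrite !normrZ (ger0_norm (_ : 0 <= 1 - `|t|)) ?subr_ge0//.
  have := ler_wpM2l (normr_ge0 t) e11.
  have /ler_wpM2l/(_ _ _ e21) : 0 <= 1 - `|t| by rewrite subr_ge0.
  lra.
have nboth : ~ (closure Omega (y + d t) /\ closure Omega (y - d t)).
  move=> [c1 c2]; apply: nox; apply: (modk _ _ c1 c2).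
    have -> : y + d t - (y - d t) = 2 *: d t.
      by apply/rowP => i; rewrite !mxE; ring.
    by rewrite normrZ gtr0_norm.
  rewrite (_ : 2^-1 *: _ = y)//.
  by apply/rowP => i; rewrite !mxE; field.
have D0 p : closure Omega p -> D p = 0.
  move=> cp; apply/eqP; rewrite eq_le dist_ge0// andbT.
  by apply: le_trans (dist_le _ cp) _; rewrite subrr normr0.
have closD p : D p = 0 -> closure Omega p.
  by move=> /(dist_eq0 C0); rewrite -(closure_id _).1//; exact: closed_closure.
(* If one end were in [Omega], its distance, hence that of the other end, would be 0, and both would
   lie in the closure. *)
exists (d t); split => // /subset_closure op; apply: nboth; split => //.
  by apply: closD; rewrite -Dt; exact: D0.
by apply: closD; rewrite Dt; exact: D0.
Qed.

(** A point [y] near [x] is on the boundary or on a short chord whose ends are boundary points near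
    [x]. There [env 0 <= g <= g x + e], and quasiconvexity carries the bound to [y]. *)
Lemma envelope0_le_near_boundary e : 0 < e -> exists2 h : R, 0 < h &
  forall x y, boundary Omega x -> closure Omega y -> `|x - y| < h ->
    env 0 y <= g x + e.
Proof.
move=> e0.
have [d0 d00 ug] := within_continuous_compact_unif (compact_boundary_domain hdom) hg e0.
have d20 : 0 < d0 / 2 by rewrite divr_gt0.
have [k k0 modk] := convexity_modulus hdom hconv d20.
exists (Num.min k (d0 / 2)); first by rewrite lt_min k0.
move=> x y bx cy; rewrite lt_min => /andP[xyk xyd].
have near_x a : boundary Omega a -> `|x - a| < d0 -> g a <= g x + e.
  by move=> ba xa; have := ug _ _ bx ba xa; rewrite ltr_norml => /andP[]; lra.
have [oy|noy] := pselect (Omega y); last first.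
  have by_ : boundary Omega y by apply/(boundaryE hdom).
  by apply: le_trans (env0_le by_) _; apply: near_x => //; lra.
have [||d [dd ny1 ny2]] := @short_exit_direction y (d0 / 2) k oy d20.
- exact: modk.
- exists x; last by rewrite distrC.
  by have [] := (boundaryE hdom x).1 bx.
have [a [b [ba bb ay by_ /(_ _ env0_qc)]]] := short_chord hdom oy ny1 ny2.
move=> /le_trans; apply; rewrite ge_max; apply/andP; split.
  apply: le_trans (env0_le ba) _; apply: near_x => //.
  by have := ler_distD y x a; rewrite (distrC y a); lra.
apply: le_trans (env0_le bb) _; apply: near_x => //.
by have := ler_distD y x b; rewrite (distrC y b); lra.
Qed.

(* The competitor is two-valued: it is low on the set of those [y] whose
   midpoint with [x] is deep inside [Omega]. *)
Lemma envelope0_ge_near_boundary e : 0 < e -> exists2 h : R, 0 < h &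
  forall x y, boundary Omega x -> closure Omega y -> `|x - y| < h ->
    g x - e <= env 0 y.
Proof.
move=> e0.
have [d0 d00 ug] := within_continuous_compact_unif (compact_boundary_domain hdom) hg e0.
have [k k0 modk] := convexity_modulus hdom hconv d00.
exists k => // x y bx cy xy.
have [cx nox] := (boundaryE hdom x).1 bx.
pose S := [set y | closure Omega y /\
  forall w : 'rV[R]_N, `|2^-1 *: (x + y) - w| < k -> Omega w].
have cS p q (t : R) : S p -> S q -> 0 < t -> t < 1 -> S (t *: p + (1 - t) *: q).
  move=> [cp Sp] [cq Sq] t0 t1; split; first exact: closure_convex.
  move=> w; set m := 2^-1 *: _ => mw.
  (* Both midpoints are translated by the same vector [w - m], so [w] is a combination of two points
     of [Omega]. *)
  have -> : w = t *: (2^-1 *: (x + p) - (m - w))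
             + (1 - t) *: (2^-1 *: (x + q) - (m - w)).
    by apply/rowP => i; rewrite !mxE; ring.
  apply: (domain_convex hconv) => //.
    by apply: Sp; rewrite opprB addrC subrK.
  by apply: subset_closure; apply: Sq; rewrite opprB addrC subrK.
(* The maximum makes [c] the larger of the two values, so the sublevel sets of [v] are empty, [S] or
   everything. *)
pose c := Num.max (- M) (g x - e).
pose v p : R := if `[< S p >] then - M else c.
have vle p : v p <= c by rewrite /v /c; case: ifP => // _; rewrite le_max lexx.
have leV p : - M <= v p by rewrite /v /c; case: ifP => // _; rewrite le_max lexx.
have vS p : ~ S p -> v p = c by rewrite /v; case: asboolP.
(* The midpoint of [x] and [y] is within [k] of [x], which is not in [Omega]. *)
have nSy : ~ S y.
  move=> [_ Sy]; apply: nox; apply: Sy.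
  have -> : 2^-1 *: (x + y) - x = - 2^-1 *: (x - y).
    by apply/rowP => i; rewrite !mxE; field.
  rewrite normrZ normrN gtr0_norm ?invr_gt0//.
  by have := normr_ge0 (x - y); lra.
suff cv : competitor 0 v.
  by apply: le_trans (le_env0 cv cy); rewrite vS// le_max lexx orbT.
split.
  apply/alpha_convex0P => p q cp cq t t0 t1.
  have [Sp|/vS vp] := pselect (S p); last first.
    by rewrite le_max vp vle.
  have [Sq|/vS vq] := pselect (S q); last first.
    by rewrite le_max vq vle orbT.
  by rewrite {1}/v asboolT ?le_max ?leV//; exact: cS.
move=> z bz; rewrite /v; case: asboolP => [_|nSz]; first exact: (le_g gM).
rewrite ge_max (le_g gM bz)/=.
have xz : `|x - z| < d0.
  rewrite ltNge; apply/negP => xz; apply: nSz.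
  have [cz _] := (boundaryE hdom z).1 bz; split => //.
  exact: modk.
by have := ug _ _ bx bz xz; rewrite ltr_norml => /andP[]; lra.
Qed.

(* Well inside [Omega], a contraction [T] of the domain carries [z'] to [z];
   the function [env 0 \o T - e] is then a competitor. *)
Lemma envelope0_unif_continuous e : 0 < e -> exists2 h : R, 0 < h &
  forall z z', closure Omega z -> closure Omega z' -> `|z - z'| < h ->
    env 0 z <= env 0 z' + e.
Proof.
move=> e0; have e20 : 0 < e / 2 by rewrite divr_gt0.
have [hA hA0 HA] := envelope0_le_near_boundary e20.
have [hB hB0 HB] := envelope0_ge_near_boundary e20.
have [B B0 Bd] := closure_domain_bounded hdom.
pose rho := Num.min hB (hA / 2).
have rho0 : 0 < rho by rewrite lt_min hB0 divr_gt0.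
have rhoB : rho <= hB by rewrite ge_min lexx.
have rhoA : rho <= hA / 2 by rewrite ge_min lexx orbT.
exists (Num.min (rho / 2) (hA * rho / (4 * B))).
  by rewrite lt_min !divr_gt0 ?mulr_gt0.
move=> z z' cz cz'; rewrite lt_min => /andP[zz1 zz2].
(* If the ball of radius [rho] about [z'] leaves [Omega], some boundary point is close to both [z]
   and [z'], and the two boundary estimates compare the values. *)
have [inside|] := pselect (forall p, `|z' - p| < rho -> Omega p); last first.
  move=> /existsNP[p /not_implyP[zp nop]].
  have [|s [s0 s1 bs]] := exit_boundary hdom cz' (d := p - z').
    by rewrite subrKC.
  set x := z' + _ in bs.
  have xz' : `|x - z'| < rho.
    rewrite addrC addKr normrZ ger0_norm// distrC.
    by apply: le_lt_trans zp; rewrite ler_piMl.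
  have := HB x z' bs cz' (lt_le_trans xz' rhoB).
  have xz : `|x - z| < hA.
    by have := ler_distD z' x z; rewrite (distrC z' z); lra.
  have := HA x z bs cz xz; lra.
have [->|zz'] := eqVneq z z'; first by rewrite lerDl ltW.
have nz : 0 < `|z - z'| by rewrite normr_gt0 subr_eq0.
(* Below, [q] is the point at distance [rho / 2] from [z'] in the direction of [z], and [s] is the
   ratio for which [T z' = z]. *)
pose s := `|z - z'| / (rho / 2).
have s0 : 0 < s by rewrite !divr_gt0.
have s1 : s < 1 by rewrite ltr_pdivrMr ?divr_gt0// mul1r.
pose q := z' + s^-1 *: (z - z').
have oq : Omega q.
  apply: inside; rewrite opprD addrA subrr add0r normrN normrZ normfV gtr0_norm//.
  by rewrite /s invf_div divfK ?gt_eqF//; lra.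
pose T y := s *: q + (1 - s) *: y.
have cT y : closure Omega y -> closure Omega (T y).
  by move=> cy; apply: subset_closure; exact: (domain_convex hconv).
have Tz' : T z' = z.
  by apply/rowP => i; rewrite !mxE; field; rewrite gt_eqF.
suff cv : competitor 0 (fun y => env 0 (T y) - e).
  by have := le_env0 cv cz'; rewrite /= Tz'; lra.
split.
  apply/alpha_convex0P => x y cx cy t t0 t1.
  have -> : T (t *: x + (1 - t) *: y) = t *: T x + (1 - t) *: T y.
    by apply/rowP => i; rewrite !mxE; ring.
  have := env0_qc (cT _ cx) (cT _ cy) t0 t1.
  by rewrite !le_max !lerBlDr !subrK.
move=> y bdy; have [cy _] := (boundaryE hdom y).1 bdy.
(* [T] moves points by at most [2 B s = 4 B |z - z'| / rho], which explains the second bound on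
   [|z - z'|]. *)
have yT : `|y - T y| < hA.
  have -> : y - T y = s *: (y - q) by apply/rowP => i; rewrite !mxE; ring.
  rewrite normrZ gtr0_norm//.
  have yq : `|y - q| <= 2 * B.
    apply: le_trans (ler_normB _ _) _.
    by have := Bd y cy; have := Bd q (subset_closure oq); lra.
  apply: le_lt_trans (ler_wpM2l (ltW s0) yq) _.
  rewrite /s mulrAC ltr_pdivrMr ?divr_gt0//.
  by move: zz2; rewrite ltr_pdivlMr ?mulr_gt0//; lra.
by have := HA y (T y) bdy (cT _ cy) yT; lra.
Qed.

(* With [c = env 0 z], the distance to the convex set [env 0 < c - e/2] is
   convex, and raising it to the exponential scale costs only [log / rate]. *)
Lemma envelope0_near e : 0 < e -> exists2 h : R, 0 < h &
  forall alpha, 0 < alpha -> alpha <= 1 -> alpha < h ->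
    forall z, closure Omega z -> env 0 z <= env alpha z + e.
Proof.
move=> e0; have e20 : 0 < e / 2 by rewrite divr_gt0.
have [r r0 uc] := envelope0_unif_continuous e20.
have [B B0 Bd] := closure_domain_bounded hdom.
(* A rate [k >= K] gives [2 B / r <= k e / 2 <= exp (k e / 2)], which absorbs [dist S y <= 2 B] off
   [S]; [alpha < (1 + K)^-1] makes the rate at least [K]. *)
pose K := 4 * B / (r * e).
have K0 : 0 < K by rewrite divr_gt0 ?mulr_gt0.
exists (1 + K)^-1 => [|alpha a0 a1 ah z cz]; first by rewrite invr_gt0 addr_gt0.
have aK : alpha * (1 + K) < 1.
  by move: ah; rewrite -[_^-1]mul1r ltr_pdivlMr// addr_gt0.
have {}a1 : alpha < 1 by nra.
have kK : K <= rate alpha.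
  by rewrite /rate ler_pdivlMr//; lra.
set k := rate alpha in kK; have k0 : 0 < k by exact: lt_le_trans kK.
set c := env 0 z.
pose S := [set y | closure Omega y /\ env 0 y < c - e / 2].
(* If [S] is empty, the constant [c - e / 2] lies below [g] and is a competitor. *)
have [S0|S0] := pselect (S !=set0); last first.
  have cc : competitor alpha (cst (c - e / 2)).
    apply: cst_competitor => // [||y bdy]; [exact: ltW|exact: ltW|].
    have [cy _] := (boundaryE hdom y).1 bdy.
    apply: le_trans (env0_le bdy); rewrite leNgt; apply/negP => ?.
    by apply: S0; exists y.
  have := le_envelope hN hdom gM (ltW a0) (ltW a1) cc cz.
  by rewrite /cst; lra.
have cS x y : S x -> S y -> forall t : R, 0 < t -> t < 1 ->
    S (t *: x + (1 - t) *: y).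
  move=> [cx Sx] [cy Sy] t t0 t1; split; first exact: closure_convex.
  by apply: le_lt_trans (env0_qc cx cy t0 t1) _; rewrite gt_max Sx.
pose A := expR (k * (c - e)).
have A0 : 0 < A by exact: expR_gt0.
(* The second term keeps [W] positive, so that its logarithm is meaningful; it is at most
   [exp (k * env 0 y)] because [env 0 y >= - M]. *)
pose W y := Num.max (A / r * dist S y) (expR (k * - M)).
have W0 y : 0 < W y by rewrite lt_max expR_gt0 orbT.
pose w y := ln (W y) / k.
have phiw y : phi alpha (w y) = W y.
  by rewrite phiE// -/k /w mulrC divfK ?gt_eqF// lnK ?posrE.
have cW : convex_on (closure Omega) W.
  apply: convex_on_max => x y cx cy t t0 t1.
  have := dist_convex S0 cS cx cy t0 t1.
  by move=> /(ler_wpM2l (ltW (divr_gt0 A0 r0))); lra.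
have w_le y : closure Omega y -> w y <= env 0 y.
  move=> cy; rewrite -(ler_phi a0 (ltW a1)) phiw phiE// -/k ge_max.
  rewrite [X in _ && X]ler_expR ler_pM2l// (le_envelopeN hN hdom gM)// andbT.
  have [Sy|nSy] := pselect (S y).
    have : dist S y <= 0.
      by apply: le_trans (dist_le y Sy) _; rewrite subrr normr0.
    have := divr_gt0 A0 r0; have := expR_gt0 (k * env 0 y); nra.
  have cle : c - e / 2 <= env 0 y.
    by rewrite leNgt; apply/negP => ?; exact: nSy.
  apply: (@le_trans _ _ (expR (k * (c - e / 2)))); last first.
    by rewrite ler_expR ler_pM2l.
  have -> : expR (k * (c - e / 2)) = A * expR (k * (e / 2)).
    by rewrite /A -expRD; congr expR; field.
  rewrite -mulrA ler_pM2l//.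
  have dB : dist S y <= 2 * B.
    have [a Sa] := S0; apply: le_trans (dist_le y Sa) _.
    apply: le_trans (ler_normB _ _) _; have [ca _] := Sa.
    by have := Bd y cy; have := Bd a ca; lra.
  apply: le_trans (expR_ge1Dx _); rewrite mulrC ler_pdivrMr//.
  have : 4 * B <= k * (r * e).
    by move: kK; rewrite /K ler_pdivrMr// mulr_gt0.
  nra.
have cw : competitor alpha w.
  split; last first.
    move=> y bdy; have [cy _] := (boundaryE hdom y).1 bdy.
    exact: le_trans (w_le y cy) (env0_le bdy).
  apply/alpha_convexP => //; first exact: ltW.
  by rewrite (_ : _ \o _ = W)//; apply/funext.
have := le_envelope hN hdom gM (ltW a0) (ltW a1) cw cz.
suff : c - e <= w z by lra.
rewrite -(ler_phi a0 (ltW a1)) phiw phiE// -/k -/A le_max; apply/orP; left.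
rewrite mulrAC ler_pdivlMr// ler_pM2l//.
(* By uniform continuity no point of [S] is within [r] of [z]. *)
apply: le_dist => // y [cy yc]; rewrite leNgt; apply/negP => zy.
by have := uc z y cz cy zy; rewrite -/c; lra.
Qed.

End QuasiconvexEnvelope.

(** * Monotonicity and uniform convergence from the pointwise estimates *)

Theorem theorem1p6 (R : realType) (N : nat) (hN : (2 <= N)%N)
    (Omega : set 'rV[R]_N) (g : 'rV[R]_N -> R)
    (hdom : bounded_domain Omega) (hconv : strictly_convex Omega)
    (hg : {within boundary Omega, continuous g}) :
  (forall alpha0 alpha : R, 0 <= alpha0 -> alpha0 <= alpha -> alpha <= 1 ->
     forall z : 'rV[R]_N, closure Omega z ->
       alpha_envelope Omega g alpha z <= alpha_envelope Omega g alpha0 z) /\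
  (forall alpha0 : R, 0 <= alpha0 -> alpha0 <= 1 ->
     {uniform closure Omega,
        alpha_envelope Omega g alpha @[alpha --> within `[0, 1] (nbhs alpha0)]
        --> alpha_envelope Omega g alpha0}).
Proof.
have [M M0 gM] : exists2 M : R, 0 < M &
    forall z, boundary Omega z -> `|g z| <= M.
  have := continuous_compact hg (compact_boundary_domain hdom).
  move=> /compact_bounded/bounded_setP[M M0 HM].
  by exists M => // z bz; apply: HM; exists z.
have mono := envelope_antitone hN hdom gM.
split=> [alpha0 alpha a00 aa a1 z cz|alpha0 a00 a01]; first exact: mono.
have near_env e : 0 < e -> exists2 h : R, 0 < h &
    forall alpha, 0 <= alpha -> alpha <= 1 -> `|alpha - alpha0| < h ->
    forall z, closure Omega z ->
      `|alpha_envelope Omega g alpha z - alpha_envelope Omega g alpha0 z| <= e.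
  move=> e0; have [a0|a0] := eqVneq alpha0 0; last first.
    apply: (envelope_near hN hdom hconv M0 gM) => //.
    by rewrite lt_neqAle eq_sym a0.
  (* At 0 all admissible exponents lie to the right: monotonicity gives one inequality and
     [envelope0_near] the other. *)
  have [h h0 H] := envelope0_near hN hdom hconv hg gM e0.
  exists h => // alpha; rewrite le_eqVlt a0 => /predU1P[<- _ _ z _|al0 al1].
    by rewrite subrr normr0 ltW.
  rewrite subr0 gtr0_norm// => alh z cz.
  rewrite distrC ger0_norm ?subr_ge0; last by apply: mono => //; exact: ltW.
  by rewrite lerBlDl; exact: H.
(* The uniform neighbourhood is reduced to an entourage of the reals, then to a radius [e]; using
   [e / 2] turns the weak inequality into a strict one. *)
move=> P /uniform_nbhs[E [/= entE EP]].
have [e /= e0 eE] : exists2 e : R, 0 < e &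
    forall a b : R, `|a - b| < e -> E (a, b).
  move: entE; rewrite -entourage_ballE => -[e /= e0 He]; exists e => // a b ab.
  exact: (He (a, b)).
have [h h0 H] := near_env (e / 2) ltac:(by rewrite divr_gt0).
apply/nbhs_ballP; exists h => //= alpha; rewrite -ball_normE /= => ah.
rewrite in_itv /= => /andP[al0 al1]; apply: EP => z cz; apply: eE.
rewrite distrC; apply: le_lt_trans (H alpha al0 al1 _ z cz) _; last by lra.
by rewrite distrC.
Qed.
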